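(* Let $(X,d)$ be a metric space. Then every real valued ward continuous function defined on $X$ can be uniformly approximated by real valued quasi-Cauchy Lipschitz functions; that is, for every ward continuous $f:X\to\mathbb{R}$ and every $\varepsilon>0$ there is a quasi-Cauchy Lipschitz function $h:X\to\mathbb{R}$ with $|h(x)-f(x)|<\varepsilon$ for every $x\in X$.
   Context: A sequence $(x_n)$ in a metric space $(X,d)$ is quasi-Cauchy if for every $\varepsilon>0$ there is $n_0$ such that $d(x_{n+1},x_n)<\varepsilon$ for all $n\ge n_0$. A function $f:(X,d)\to(Y,\rho)$ between metric spaces is ward continuous if it maps quasi-Cauchy sequences in $X$ to quasi-Cauchy sequences in $Y$. It is quasi-Cauchy Lipschitz if for any quasi-Cauchy sequence $(x_n)$ in $X$ there exists $\lambda>0$ such that $\rho(f(x_k),f(x_{k+1}))\le\lambda d(x_k,x_{k+1})$ for all $k\in\mathbb{N}$. $\mathbb{R}$ carries its usual metric. *)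

(* Defs.v *)
From mathcomp Require Import all_boot all_order all_algebra.
From mathcomp Require Import all_classical all_reals all_analysis.

Set Implicit Arguments.
Unset Strict Implicit.
Unset Printing Implicit Defensive.

Import Order.TTheory GRing.Theory Num.Theory.
Import numFieldNormedType.Exports.

Local Open Scope ring_scope.

Definition quasi_cauchy (R : realType) (X : metricType R) (x : nat -> X) : Prop :=
  forall e : R, 0 < e ->
    exists n0 : nat, forall n : nat, (n0 <= n)%N -> mdist (x n.+1) (x n) < e.

Definition ward_continuous (R : realType) (X Y : metricType R) (f : X -> Y) : Prop :=
  forall x : nat -> X, quasi_cauchy x -> quasi_cauchy (fun n => f (x n)).

Definition quasi_cauchy_lipschitz (R : realType) (X Y : metricType R) (f : X -> Y) : Prop :=
  forall x : nat -> X, quasi_cauchy x ->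
    exists lambda : R, 0 < lambda /\
      forall k : nat, mdist (f (x k)) (f (x k.+1)) <= lambda * mdist (x k) (x k.+1).

(* The library puts the metric |y - x| on R^o, the copy of R as a module over itself. *)
Lemma mdist_realE (R : realType) (x y : R) : mdist (x : R^o) (y : R^o) = `|y - x|.
Proof. by []. Qed.

(* Main.v *)
(** Given [e > 0], let [delta x] be the infimum of [1] and of all
    [d(x, y) + d(x, z)] with [|f y - f z| >= e].  It is 2-Lipschitz, and ward
    continuity bounds it below along the tail of every quasi-Cauchy sequence
    [x]: otherwise there are pairs [(y, z)] with [|f y - f z| >= e] arbitrarily
    close to terms of [x], and inserting them into [x] gives a quasi-Cauchy
    sequence whose image is not quasi-Cauchy.  The approximation is the local
    infimal convolution
    [h x = inf {f y + 4 e d(x, y) / delta x | d(x, y) < delta x}], which is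
    Lipschitz at small scales wherever [delta] is bounded below. *)
Require Import Defs.
From mathcomp Require Import all_boot all_order all_algebra.
From mathcomp Require Import all_classical all_reals all_analysis.
From mathcomp Require Import zify ring lra.

Import Order.TTheory GRing.Theory Num.Theory.
Import numFieldNormedType.Exports.

Local Open Scope ring_scope.

(** * Inserting close pairs into a quasi-Cauchy sequence *)

Definition interleave3 {T : Type} (x y z : nat -> T) (n : nat) : T :=
  nth (z (n %/ 3)%N) [:: x (n %/ 3)%N; y (n %/ 3)%N] (n %% 3)%N.

Lemma interleave3E {T : Type} (x y z : nat -> T) (k : nat) :
  (interleave3 x y z (k * 3)%N = x k) *
  (interleave3 x y z (k * 3).+1%N = y k) *
  (interleave3 x y z (k * 3).+2%N = z k).
Proof.
have H r : (r < 3)%N -> interleave3 x y z (k * 3 + r)%N =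
    nth (z k) [:: x k; y k] r.
  by move=> r3; rewrite /interleave3 divnMDl// divn_small// addn0 modnMDl modn_small.
by rewrite -{1}[(k * 3)%N]addn0 -[(k * 3).+2]addn2 -[(k * 3).+1]addn1 !H.
Qed.

(** The steps run [x k], [y k], [z k], [x k.+1]. By the triangle inequality through [x k], each is
    at most [d(x k, y k) + d(x k, z k) + d(x k, x k.+1)]. *)
Lemma quasi_cauchy_interleave3 {R : realType} {X : metricType R}
    (x y z : nat -> X) :
  quasi_cauchy x ->
  (forall e : R, 0 < e -> exists n0, forall n, (n0 <= n)%N ->
    mdist (x n) (y n) + mdist (x n) (z n) < e) ->
  quasi_cauchy (interleave3 x y z).
Proof.
move=> xqc yz e e0; have e20 : 0 < e / 2 by lra.
have [N1 H1] := xqc _ e20; have [N2 H2] := yz _ e20.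
exists (maxn N1 N2 * 3)%N => n Nn.
have Hk : (maxn N1 N2 <= n %/ 3)%N by rewrite leq_divRL.
have {H1} := H1 _ (leq_trans (leq_maxl _ _) Hk).
have {H2} := H2 _ (leq_trans (leq_maxr _ _) Hk).
set k := (n %/ 3)%N => H2 H1.
have d1 := mdist_ge0 (x k) (y k); have d2 := mdist_ge0 (x k) (z k).
have : (n = k * 3 \/ n = (k * 3).+1 \/ n = (k * 3).+2)%N by rewrite /k; lia.
case=> [->|[->|->]].
- by rewrite !interleave3E metric_sym; lra.
- rewrite !interleave3E (le_lt_trans (metric_triangle _ (x k) _))//.
  by rewrite (metric_sym (z k)); lra.
- have -> : (k * 3).+3 = (k.+1 * 3)%N by lia.
  rewrite !interleave3E (le_lt_trans (metric_triangle _ (x k) _))//; lra.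
Qed.

Lemma ward_continuous_osc {R : realType} {X Y : metricType R} (f : X -> Y)
    (x : nat -> X) (e : R) :
  ward_continuous f -> quasi_cauchy x -> 0 < e ->
  exists d : R, 0 < d /\ exists N, forall k, (N <= k)%N -> forall y z,
    mdist (x k) y + mdist (x k) z < d -> mdist (f y) (f z) < e.
Proof.
move=> wf xqc e0; apply: contrapT => nosc.
have bad j : exists t : nat * X * X, [/\ (j <= t.1.1)%N,
    mdist (x t.1.1) t.1.2 + mdist (x t.1.1) t.2 < j.+1%:R^-1 &
    e <= mdist (f t.1.2) (f t.2)].
  apply: contrapT => nj; apply: nosc; exists j.+1%:R^-1; split; first by rewrite invr_gt0.
  exists j => k jk y z yz; rewrite ltNge; apply/negP => fyz.
  by apply: nj; exists (k, y, z).
have {bad}[t /all_and3[ge_t dist_t gap_t]] := choice bad.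
(* At the index [k] insert the pair of any [j] with [(t j).1.1 = k]; each [j]
   occurs at only one [k], so the inserted pairs get close to [x]. *)
pose sel k : option nat := if pselect (exists j, (t j).1.1 = k) is left ex
  then Some (projT1 (cid ex)) else None.
have selP k j : sel k = Some j -> (t j).1.1 = k.
  by rewrite /sel; case: pselect => // ex [<-]; exact: projT2 (cid ex).
have selT j : exists i, sel (t j).1.1 = Some i.
  by rewrite /sel; case: pselect => [ex|[]]; [eexists | exists j].
pose y k := if sel k is Some j then (t j).1.2 else x k.
pose z k := if sel k is Some j then (t j).2 else x k.
have yz (d : R) : 0 < d -> exists n0, forall n, (n0 <= n)%N ->
    mdist (x n) (y n) + mdist (x n) (z n) < d.
  (* Every [j > J] has [1 / (j + 1) < d]. Beyond the largest index attached to a pair [j <= J], only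
     pairs with [j > J] can be inserted. *)
  move=> d0; pose J := Num.truncn d^-1.
  exists (\max_(j < J.+1) (t j).1.1).+1 => n Jn; rewrite /y /z.
  case E: (sel n) => [j|]; last by rewrite mdistxx addr0.
  have tj := selP _ _ E; rewrite -tj (lt_trans (dist_t j))//.
  have Jj : (J < j)%N.
    rewrite ltnNge; apply/negP => jJ.
    have := leq_bigmax (F := fun i : 'I_J.+1 => (t i).1.1) (Ordinal (jJ : (j < J.+1)%N)).
    by rewrite /= tj => /(leq_trans Jn); rewrite ltnn.
  rewrite invf_plt ?posrE// (lt_le_trans (truncnS_gt _))//.
  by rewrite ler_nat ltnW.
have [N HN] := wf _ (quasi_cauchy_interleave3 _ _ _ xqc yz) e e0.
(* At index [(t N).1.1 >= N] the selected pair [i] may differ from [N], but every pair has gap at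
   least [e], so the step from [y] to [z] there contradicts [HN]. *)
have [i Ei] := selT N.
have := HN ((t N).1.1 * 3).+1%N; rewrite !interleave3E /y /z Ei metric_sym.
have := ge_t N => tN /(_ ltac:(lia)).
by rewrite ltNge gap_t.
Qed.

(** * The radius within which the function oscillates by less than [e] *)

Section OscillationRadius.
Context {R : realType} {X Y : metricType R} (f : X -> Y) (e : R).

(** The element [1] keeps the set nonempty when no pair has gap [e], so that the infimum is never a
    default value. *)
Let near_gap (x : X) : set R := [set r | r = 1 \/
  exists y z, e <= mdist (f y) (f z) /\ r = mdist x y + mdist x z]%classic.

Definition osc_radius (x : X) : R := inf (near_gap x).

Let near_gap_lb x : has_lbound (near_gap x).
Proof.
by exists 0 => _ [->//|[y [z [_ ->]]]]; rewrite addr_ge0// mdist_ge0.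
Qed.

Let near_gap_neq0 x : (near_gap x !=set0)%classic.
Proof. by exists 1; left. Qed.

Lemma osc_radius_le1 x : osc_radius x <= 1.
Proof. by apply: ge_inf => //; left. Qed.

Lemma osc_radius_gap x y z :
  mdist x y + mdist x z < osc_radius x -> mdist (f y) (f z) < e.
Proof.
rewrite !ltNge; apply: contra => fyz.
by apply: ge_inf => //; right; exists y, z.
Qed.

Lemma osc_radius_ge x d : d <= 1 ->
  (forall y z, mdist x y + mdist x z < d -> mdist (f y) (f z) < e) ->
  d <= osc_radius x.
Proof.
move=> d1 H; apply: lb_le_inf => // _ [->//|[y [z [fyz ->]]]].
by rewrite leNgt; apply/negP => /H; rewrite ltNge fyz.
Qed.

(** Moving the centre from [x'] to [x] changes each of the two distances to a gap pair by at most
    [d(x, x')], whence the factor 2. *)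
Lemma osc_radius_lipschitz x x' :
  osc_radius x <= osc_radius x' + 2 * mdist x x'.
Proof.
rewrite -lerBlDr; apply: lb_le_inf => // _ [->|[y [z [fyz ->]]]].
  by have := osc_radius_le1 x; have := mdist_ge0 x x'; lra.
have : osc_radius x <= mdist x y + mdist x z.
  by apply: ge_inf => //; right; exists y, z.
have := metric_triangle x x' y; have := metric_triangle x x' z; lra.
Qed.

Lemma osc_radius_tail (x : nat -> X) :
  ward_continuous f -> quasi_cauchy x -> 0 < e ->
  exists d, 0 < d /\ exists N, forall k, (N <= k)%N -> d <= osc_radius (x k).
Proof.
move=> wf xqc e0; have [d [d0 [N HN]]] := ward_continuous_osc f x e wf xqc e0.
exists (Num.min d 1); split; first by rewrite lt_min d0 ltr01.
exists N => k Nk; apply: osc_radius_ge; first by rewrite ge_min lexx orbT.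
by move=> y z; rewrite lt_min => /andP[/HN + _]; exact.
Qed.

(** The tail bound is applied to the constant sequence at [x]. *)
Lemma osc_radius_gt0 x : ward_continuous f -> 0 < e -> 0 < osc_radius x.
Proof.
move=> wf e0; have xqc : quasi_cauchy (fun=> x).
  by move=> d d0; exists 0%N => n _; rewrite mdistxx.
have [d [d0 [N HN]]] := osc_radius_tail _ wf xqc e0.
exact: lt_le_trans (HN N (leqnn N)).
Qed.

End OscillationRadius.

(** * Infimal convolution over balls of variable radius *)

Section LocalInfConvolution.
Context {R : realType} {X : metricType R} (f : X -> R) (e : R) (delta : X -> R).
Hypothesis delta_gt0 : forall x, 0 < delta x.
Hypothesis delta_lipschitz : forall x x', delta x <= delta x' + 2 * mdist x x'.
Hypothesis delta_osc : forall x y, mdist x y < delta x -> `|f y - f x| < e.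

Let values (x : X) : set R := [set r | exists y, mdist x y < delta x /\
  r = f y + 4 * e * (mdist x y / delta x)]%classic.

Definition local_inf_conv (x : X) : R := inf (values x).

(** A point is required: positivity comes from [delta_osc] on the pair [x], [x]. *)
Let e_gt0 (x : X) : 0 < e.
Proof. by have := delta_osc x x; rewrite mdistxx subrr normr0; exact. Qed.

Let osc_bounds x y : mdist x y < delta x -> f x - e < f y < f x + e.
Proof. by move/delta_osc; rewrite ltr_distl. Qed.

Let values_self x : values x (f x).
Proof. by exists x; rewrite mdistxx mul0r mulr0 addr0. Qed.

Let values_ge x : lbound (values x) (f x - e).
Proof.
move=> _ [y [xy ->]]; have /andP[+ _] := osc_bounds _ _ xy.
have : 0 <= 4 * e * (mdist x y / delta x).
  by rewrite mulr_ge0 ?divr_ge0 ?mdist_ge0 ?mulr_ge0// ltW// (e_gt0 x).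
lra.
Qed.

Let values_lb x : has_lbound (values x).
Proof. by exists (f x - e); exact: values_ge. Qed.

Lemma local_inf_conv_le x : local_inf_conv x <= f x.
Proof. exact: ge_inf. Qed.

Lemma local_inf_conv_ge x : f x - e <= local_inf_conv x.
Proof. by apply: lb_le_inf; [exists (f x) | exact: values_ge]. Qed.

(** Each competitor [y] for [x] either has a penalty so large that [f x'] already lies below its
    value, or is close enough to [x] to compete for [x'] as well. *)
Let local_inf_conv_leD x x' d : 0 < d -> d <= delta x -> d <= delta x' ->
  6 * mdist x x' < d ->
  local_inf_conv x' <= local_inf_conv x + 8 * e / d * mdist x x'.
Proof.
move=> d0 dx dx' xx'd; have e0 := e_gt0 x.
have D0 := mdist_ge0 x x'; set D := mdist x x' in xx'd D0 *.
have L0 : 0 <= 8 * e / d * D by rewrite mulr_ge0// divr_ge0 ?mulr_ge0// ltW.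
rewrite -lerBlDr; apply: lb_le_inf; first by exists (f x).
move=> _ [y [xy ->]].
have xy0 := mdist_ge0 x y.
have [far|near] := leP (1 / 2) (mdist x y / delta x).
- (* Here the penalty exceeds the oscillation of [f] on the ball. *)
  have /andP[_ fx'] : f x - e < f x' < f x + e.
    by apply: osc_bounds; rewrite -/D; lra.
  have /andP[fy _] := osc_bounds _ _ xy.
  have := local_inf_conv_le x'.
  have : 4 * e * (1 / 2) <= 4 * e * (mdist x y / delta x).
    by rewrite ler_wpM2l// mulr_ge0// ltW.
  lra.
have xyh : mdist x y < delta x / 2.
  by move: near; rewrite ltr_pdivrMr//; lra.
have tri := metric_triangle x' x y.
rewrite (metric_sym x' x) -/D in tri.
have lip := delta_lipschitz x x'; rewrite -/D in lip.
(* Here [d(x', y) < D + delta x / 2 <= delta x' / 2 + 2 D], and [6 D < d <= delta x'] gives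
   [2 D < delta x' / 3]. *)
have x'y : mdist x' y < delta x' by lra.
have : local_inf_conv x' <= f y + 4 * e * (mdist x' y / delta x').
  by apply: ge_inf => //; exists y.
suff : 4 * e * (mdist x' y / delta x') <=
    4 * e * (mdist x y / delta x) + 8 * e / d * D by lra.
have -> : 8 * e / d * D = 4 * e * (2 * D / d).
  by ring.
have e40 : 0 <= 4 * e by lra.
rewrite -mulrDr ler_wpM2l//.
have d'0 := delta_gt0 x'.
set q := mdist x y / delta x in near *.
have q0 : 0 <= q by rewrite divr_ge0// ltW.
have qE : mdist x y = q * delta x by rewrite divfK// gt_eqF.
(* Since [q < 1/2], [d(x', y) <= D + q (delta x' + 2 D) <= q delta x' + 2 D]. The factor 2, times
   the slope [4 e], yields the constant [8 e / d]. *)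
apply: (@le_trans _ _ (q + 2 * D / delta x')); last first.
  rewrite lerD2l ler_wpM2l ?mulr_ge0//.
  by rewrite lef_pV2 ?posrE.
rewrite ler_pdivrMr// mulrDl divfK ?gt_eqF//.
have : q * delta x <= q * (delta x' + 2 * D) by rewrite ler_wpM2l.
have : q * (2 * D) <= 1 / 2 * (2 * D).
  by rewrite ler_wpM2r ?mulr_ge0 ?(ltW near).
lra.
Qed.

Lemma local_inf_conv_lipschitz x x' d : 0 < d -> d <= delta x ->
  d <= delta x' -> 6 * mdist x x' < d ->
  `|local_inf_conv x' - local_inf_conv x| <= 8 * e / d * mdist x x'.
Proof.
move=> d0 dx dx' xx'; rewrite ler_distl local_inf_conv_leD// andbT lerBlDr.
by rewrite metric_sym local_inf_conv_leD// metric_sym.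
Qed.

End LocalInfConvolution.

(** * From tails to whole sequences, and the approximation *)

Lemma lipschitz_steps_of_tail {R : realType} {X Y : metricType R} (h : X -> Y)
    (x : nat -> X) (L : R) (N : nat) : 0 < L ->
  (forall k, (N <= k)%N ->
    mdist (h (x k)) (h (x k.+1)) <= L * mdist (x k) (x k.+1)) ->
  exists lambda : R, 0 < lambda /\ forall k,
    mdist (h (x k)) (h (x k.+1)) <= lambda * mdist (x k) (x k.+1).
Proof.
move=> L0 HN.
(* The finitely many steps before [N] are absorbed by adding their ratios to [L]. Where the
   denominator vanishes the two points coincide, so both sides of [rE] are 0. *)
pose r k := mdist (h (x k)) (h (x k.+1)) / mdist (x k) (x k.+1).
have r0 k : 0 <= r k by rewrite divr_ge0 ?mdist_ge0.
have rE k : mdist (h (x k)) (h (x k.+1)) = r k * mdist (x k) (x k.+1).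
  have [xx|nxx] := eqVneq (mdist (x k) (x k.+1)) 0; last by rewrite divfK.
  by rewrite xx mulr0 (mdist_positivity _ _ xx) mdistxx.
have S0 : 0 <= \sum_(i < N) r i by rewrite sumr_ge0.
exists (L + \sum_(i < N) r i); split; first by rewrite ltr_wpDr.
move=> k; have [kN|Nk] := ltnP k N; last first.
  by rewrite (le_trans (HN k Nk))// ler_wpM2r ?mdist_ge0// lerDl.
rewrite rE ler_wpM2r ?mdist_ge0// (bigD1 (Ordinal kN))//=.
have : 0 <= \sum_(i < N | i != Ordinal kN) r i by rewrite sumr_ge0.
lra.
Qed.

Theorem theorem4p6 (R : realType) (X : metricType R) (f : X -> R) :
  ward_continuous (f : X -> R^o) ->
  forall e : R, 0 < e ->
    exists h : X -> R,
      quasi_cauchy_lipschitz (h : X -> R^o) /\ forall x : X, `|h x - f x| < e.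
Proof.
(* The bounds [f x - e1 <= h x <= f x] are not strict; halving [e] makes the final estimate
   strict. *)
move=> wf e e0; pose e1 := e / 2; have e10 : 0 < e1 by rewrite /e1; lra.
pose delta := osc_radius (f : X -> R^o) e1.
have delta0 x : 0 < delta x by exact: osc_radius_gt0.
have deltaL x x' : delta x <= delta x' + 2 * mdist x x'.
  exact: osc_radius_lipschitz.
have deltaO x y : mdist x y < delta x -> `|f y - f x| < e1.
  move=> xy; rewrite -mdist_realE; apply: (osc_radius_gap _ _ x).
  by rewrite mdistxx add0r.
exists (local_inf_conv f e1 delta); split; last first.
  move=> x; rewrite ltr_distl.
  have := local_inf_conv_le f e1 delta delta0 deltaO x.
  have := local_inf_conv_ge f e1 delta delta0 deltaO x.
  rewrite /e1; lra.
move=> x xqc.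
have [d [d0 [N1 HN1]]] := osc_radius_tail _ _ x wf xqc e10.
have [N2 HN2] := xqc (d / 6) ltac:(lra).
apply: (@lipschitz_steps_of_tail _ _ R^o _ _ (8 * e1 / d) (maxn N1 N2)).
  by rewrite divr_gt0// mulr_gt0.
move=> k; rewrite geq_max => /andP[N1k N2k].
rewrite mdist_realE; apply: local_inf_conv_lipschitz => //.
- exact: HN1.
- by apply: HN1; rewrite leqW.
- by have := HN2 k N2k; rewrite metric_sym; lra.
Qed.
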